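(* Let $n$ be a positive integer. Then the following three identities hold: \[ 2n\,\sigma(2n+1)=\sum_{j=1}^\infty \big(5j(j+1)- 2n \big)\, \sigma\big(2n+1-j(j+1)\big); \] \[ \sum_{j=0}^\infty\Big( \sigma\big(n-j(j+1)/2\big)- 4\,\sigma\big(\tfrac{1}{2}(n-j(j+1)/2)\big)\Big) = \begin{cases} n, & \text{if } n=j(j+1)/2 \text{ for some integer } j; \\ 0, &\text{otherwise}; \end{cases} \] \[ n\,\sigma(2n+1)= 4\sum_{j=1}^\infty \big(\sigma(j)- 4\,\sigma(j/2)\big)\, \sigma(2n+1-2j). \]
   Context: For a positive integer $m$, $\sigma(m)$ denotes the sum of the positive divisors of $m$. By convention $\sigma(x)=0$ whenever $x$ is not a positive integer; in particular $\sigma(m/2)=0$ if $m$ is odd, and $\sigma(m)=0$ for $m\le 0$ (so all sums above are finite). *)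

(* Defs.v *)
From mathcomp Require Import all_boot all_order all_algebra archimedean.
From mathcomp Require Import boolp classical_sets fsbigop.

Set Implicit Arguments.
Unset Strict Implicit.
Unset Printing Implicit Defensive.

Import Order.TTheory GRing.Theory Num.Theory.
Local Open Scope ring_scope.

(* The sum of the positive divisors of x, extended by 0 to every rational x
   that is not a positive integer. The test [0 < x] is needed because
   [divisors 0 = [:: 1]]. *)
Definition sigma (x : rat) : rat :=
  if (x \is a Num.int) && (0 < x)
  then (\sum_(d <- divisors `|numq x|) d)%N%:R
  else 0.

(* The infinite sums of the statement are written with the finitely supported
   sums of fsbigop. Those are 0 when the support is infinite; since sigma
   vanishes on nonpositive arguments this never happens here. *)
Lemma sigma_le0 (x : rat) : x <= 0 -> sigma x = 0.
Proof. by move=> x0; rewrite /sigma ltNge x0 andbF. Qed.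

(* Main.v *)
(** Put x = 2 e + 1.  The solutions of e (e + 1) + y z = P with y, z > 0 are the
    integral binary forms (y, x, - z) of discriminant 4 P + 1.  Changing the
    sign of x and exchanging y and z permute them, and the Zagier--Heath-Brown
    map (x, y, z) |-> (- x - 2 y, y, z - x - y) is an involution of those with
    z > x + y.  Combining these symmetries gives a Liouville type identity which
    reduces a sum over all solutions to one over the boundary z = x + y, which
    is empty unless P is pronic.

    For P = 2 n + 1 and the function (y z - x^2) y this is the first identity.
    For P = 2 n and the function [z even] (-1)^(y - 1) y it is the second one,
    since sigma(m) - 4 sigma(m / 2) is the sum of (-1)^(d - 1) d over d | m.

    With psi = sum_j q^(j (j + 1) / 2), L = sum_m (sigma(m) - 4 sigma(m / 2)) q^m,
    F = sum_i sigma(2 i + 1) q^i and D = q d/dq, the first two identities read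
    psi D F = 4 F D psi and D psi = L psi.  Cancelling psi in
    psi D F = 4 L F psi gives the third identity, D F = 4 L F. *)

Require Import Defs.
From mathcomp Require Import all_boot all_order all_algebra archimedean.
From mathcomp Require Import boolp classical_sets fsbigop.
From mathcomp Require Import zify ring.

Set Implicit Arguments.
Unset Strict Implicit.
Unset Printing Implicit Defensive.
Import Order.TTheory GRing.Theory Num.Theory.
Local Open Scope ring_scope.

(** On the entries of [s] that satisfy [p], [phi] is its own inverse, hence it permutes them. *)
Lemma big_involution (T : eqType) (V : nmodType) (s : seq T) (p : pred T)
    (phi : T -> T) (F : T -> V) :
  uniq s ->
  {in s, forall t, p t -> [/\ phi t \in s, p (phi t) & phi (phi t) = t]} ->
  \sum_(t <- s | p t) F (phi t) = \sum_(t <- s | p t) F t.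
Proof.
move=> us phiP; rewrite -big_filter -[RHS]big_filter -(big_map phi xpredT).
apply/perm_big/uniq_perm; rewrite ?filter_uniq //.
  rewrite map_inj_in_uniq ?filter_uniq // => t1 t2; rewrite !mem_filter.
  move=> /andP[p1 s1] /andP[p2 s2] eqt.
  by have [_ _ <-] := phiP _ s1 p1; have [_ _ <-] := phiP _ s2 p2; rewrite eqt.
move=> t; apply/mapP/idP => [[t' +] ->|]; rewrite mem_filter => /andP[pt st].
  by have [st' pt' _] := phiP _ st pt; rewrite mem_filter pt' st'.
have [st' pt' eqt] := phiP _ st pt.
by exists (phi t); rewrite ?mem_filter ?pt' ?st'.
Qed.

(** * Enumeration of the solutions of e (e + 1) + y z = P *)

Local Notation triple := (int * int * int)%type.

Definition pronic_below (P : nat) : seq nat :=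
  [seq j <- iota 0 P | (j * j.+1 < P)%N].
(* [Negz j] is [- j - 1], the other root of [e (e + 1) = j (j + 1)]. *)
Definition pronic_roots (P : nat) : seq int :=
  map Posz (pronic_below P) ++ map Negz (pronic_below P).
(** The absolute value only serves to land in [nat]: on [pronic_roots P] the difference is
    positive. *)
Definition remainder (P : nat) (e : int) : nat := absz (P%:Z - e * (e + 1))%R.

(** Once e is fixed, y z is the remainder, so y runs over its divisors and determines z. *)
Definition sols (P : nat) : seq triple :=
  [seq (e, Posz d, Posz (remainder P e %/ d)) |
    e <- pronic_roots P, d <- divisors (remainder P e)].

Lemma mem_pronic_below P j : (j \in pronic_below P) = (j * j.+1 < P)%N.
Proof. by rewrite mem_filter mem_iota add0n; case: ltnP => //= h; nia. Qed.

Lemma pronic_below_uniq P : uniq (pronic_below P).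
Proof. by rewrite filter_uniq ?iota_uniq. Qed.

Lemma mem_pronic_roots P e : (e \in pronic_roots P) = (e * (e + 1) < P%:Z).
Proof.
rewrite mem_cat; case: e => j.
  rewrite mem_map; last by move=> ? ? [].
  rewrite mem_pronic_below; case: mapP => [[? _] //|_]; rewrite orbF; lia.
rewrite orbC mem_map; last by move=> ? ? [].
rewrite mem_pronic_below; case: mapP => [[? _] //|_]; rewrite orbF NegzE; lia.
Qed.

Lemma pronic_roots_uniq P : uniq (pronic_roots P).
Proof.
rewrite cat_uniq !map_inj_uniq ?pronic_below_uniq; try by move=> ? ? [].
by rewrite andbT; apply/hasPn => _ /mapP[j _ ->]; apply/mapP => -[].
Qed.

Lemma mem_sols P e y z :
  ((e, y, z) \in sols P) = [&& e * (e + 1) + y * z == P%:Z, 0 < y & 0 < z].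
Proof.
apply/allpairsPdep/idP => [[e'] [d] [+ + [-> -> ->]]|/and3P[/eqP eqP y0 z0]].
  rewrite mem_pronic_roots => lte; have c0 : (0 < remainder P e')%N.
    by rewrite /remainder; lia.
  rewrite -dvdn_divisors // => dvd; have d0 := dvdn_gt0 c0 dvd.
  rewrite -PoszM mulnC divnK // -[0]/(Posz 0) !ltz_nat d0 divn_gt0 // dvdn_leq //.
  by rewrite /remainder; lia.
have cE : remainder P e = (`|y| * `|z|)%N by rewrite /remainder; nia.
exists e, `|y|%N; rewrite mem_pronic_roots cE -dvdn_divisors; last by nia.
split; [nia | exact: dvdn_mulr|].
by rewrite mulKn; [congr (_, _, _); lia | lia].
Qed.

Lemma sols_uniq P : uniq (sols P).
Proof.
apply: allpairs_uniq_dep; first exact: pronic_roots_uniq.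
  by move=> e _; exact: divisors_uniq.
by move=> [e1 d1] [e2 d2] _ _ /= [-> -> _].
Qed.

(** The roots j and - j - 1 leave the same remainder, so they share one sum over divisors. *)
Lemma big_sols P (F : triple -> int) :
  \sum_(t <- sols P) F t =
  \sum_(j <- pronic_below P) \sum_(d <- divisors (P - j * j.+1))
     (F (Posz j, Posz d, Posz ((P - j * j.+1) %/ d)) +
      F (Negz j, Posz d, Posz ((P - j * j.+1) %/ d))).
Proof.
rewrite big_allpairs_dep big_cat /= !big_map -big_split /=.
rewrite [LHS]big_seq [RHS]big_seq; apply: eq_bigr => j.
rewrite mem_pronic_below => jP.
have -> : remainder P (Posz j) = (P - j * j.+1)%N by rewrite /remainder; lia.
have -> : remainder P (Negz j) = (P - j * j.+1)%N
  by rewrite /remainder NegzE; lia.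
by rewrite -big_split.
Qed.

(** * Symmetries of the solutions and the Liouville type identity *)

Definition flip (t : triple) : triple := let: (e, y, z) := t in (- 1 - e, y, z).
Definition swap (t : triple) : triple := let: (e, y, z) := t in (e, z, y).
Definition slide (t : triple) : triple :=
  let: (e, y, z) := t in (- 1 - e - y, y, z - (2 * e + 1) - y).
Definition gap (t : triple) : int := let: (e, y, z) := t in z - (2 * e + 1) - y.

Lemma big_flip P (F : triple -> int) :
  \sum_(t <- sols P) F (flip t) = \sum_(t <- sols P) F t.
Proof.
apply: (big_involution (p := xpredT)); first exact: sols_uniq.
move=> [[e y] z] + _; rewrite /= !mem_sols => /and3P[/eqP ? ? ?]; split=> //.
  by apply/and3P; split=> //; apply/eqP; lia.
by congr (_, _, _); lia.
Qed.

Lemma big_swap P (F : triple -> int) :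
  \sum_(t <- sols P) F (swap t) = \sum_(t <- sols P) F t.
Proof.
apply: (big_involution (p := xpredT)); first exact: sols_uniq.
move=> [[e y] z] + _; rewrite /= !mem_sols => /and3P[/eqP ? ? ?]; split=> //.
by apply/and3P; split=> //; apply/eqP; lia.
Qed.

(** [slide] exchanges z and the gap: a positive gap makes the new z positive, and z > 0 makes the
    new gap positive. *)
Lemma big_slide P (F : triple -> int) :
  \sum_(t <- sols P | 0 < gap t) F (slide t) = \sum_(t <- sols P | 0 < gap t) F t.
Proof.
apply: big_involution; first exact: sols_uniq.
move=> [[e y] z]; rewrite /= !mem_sols => /and3P[/eqP ? ? ?] ?; split.
- by apply/and3P; split; [apply/eqP; lia| lia|lia].
- lia.
- by congr (_, _, _); lia.
Qed.

(** Flip-swap sends (x, y, z) to (- x, z, y), where x = 2 e + 1, and so negates z - x - y. *)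
Lemma big_gap_neg P (F : triple -> int) :
  \sum_(t <- sols P | gap t < 0) F t =
  \sum_(t <- sols P | 0 < gap t) F (flip (swap t)).
Proof.
have gapN t : gap (flip (swap t)) = - gap t.
  by case: t => [[e y] z] /=; lia.
transitivity (\sum_(t <- sols P) if gap t < 0 then F t else 0).
  by rewrite big_mkcond.
rewrite -big_flip -big_swap [RHS]big_mkcond /=.
by apply: eq_bigr => t _; rewrite gapN oppr_lt0.
Qed.

Lemma big_sols_gap P (F : triple -> int) :
  (forall t, F (flip (swap t)) = F t) ->
  \sum_(t <- sols P) F t =
  2 * \sum_(t <- sols P | 0 < gap t) F t + \sum_(t <- sols P | gap t == 0) F t.
Proof.
move=> Fk; rewrite (bigID (fun t => 0 < gap t)) /=.
rewrite (bigID (fun t => gap t < 0) (fun t => ~~ _)) /= addrA; congr (_ + _).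
  rewrite mulr2n mulrDl !mul1r; congr (_ + _).
  rewrite (eq_bigl (fun t => gap t < 0)) ?big_gap_neg; first exact: eq_bigr.
  by move=> t; lia.
by apply: eq_bigl => t; lia.
Qed.

(* Flipping kills the sum of [u] and sliding kills that of [h + u] over positive
   gaps, while flip-swap exchanges positive and negative gaps. *)
Lemma liouville P (h u : triple -> int) :
  (forall t, h (flip (swap t)) = h t) -> (forall t, u (flip (swap t)) = u t) ->
  (forall t, u (flip t) = - u t) ->
  (forall t : triple, t \in sols P ->
     h (slide t) + u (slide t) = - (h t + u t)) ->
  \sum_(t <- sols P) h t = \sum_(t <- sols P | gap t == 0) (h t + u t).
Proof.
move=> hk uk uf hus.
have u0 : \sum_(t <- sols P) u t = 0.
  have := big_flip P u; under eq_bigr do rewrite uf.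
  by rewrite sumrN => /eqP; rewrite eqNr => /eqP.
have hu0 : \sum_(t <- sols P | 0 < gap t) (h t + u t) = 0.
  have := big_slide P (fun t => h t + u t).
  rewrite big_seq_cond (eq_bigr (fun t => - (h t + u t))).
    by rewrite -big_seq_cond sumrN => /eqP; rewrite eqNr => /eqP.
  by move=> t /andP[/hus].
transitivity (\sum_(t <- sols P) (h t + u t)).
  by rewrite big_split /= u0 addr0.
by rewrite big_sols_gap ?hu0 ?mulr0 ?add0r // => t; rewrite hk uk.
Qed.

(** Substituting z = 2 e + 1 + y turns the equation into (e + y) (e + y + 1) = P. Moreover y + z = 2
    (e + y) + 1 is positive, so k = e + y is nonnegative. *)
Lemma gap_eq0 P e y z : (e, y, z) \in sols P -> gap (e, y, z) = 0 ->
  exists2 k : nat, P = (k * k.+1)%N & [/\ e = k%:Z - y & z = (k.*2.+1)%:Z - y].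
Proof.
rewrite mem_sols /= => /and3P[/eqP eqP y0 z0] g0.
have [k kE] : exists k : nat, e + y = k%:Z by exists (absz (e + y)%R); lia.
by exists k; [nia | split; lia].
Qed.

(** * The first identity, from P = 2 n + 1 *)

Definition sig (m : nat) : nat := \sum_(d <- divisors m) d.

Lemma sols_odd_sum n :
  \sum_(t <- sols n.*2.+1) (let: (e, y, z) := t in
     (y * z - (2 * e + 1) ^+ 2) * y) = 0.
Proof.
pose F (t : triple) : int :=
  let: (e, y, z) := t in (y * z - (2 * e + 1) ^+ 2) * y.
suff: \sum_(t <- sols n.*2.+1) (F t + F (swap t)) = 0.
  rewrite big_split /= (big_swap _ F) -mulr2n => /eqP.
  by rewrite mulrn_eq0 => /eqP.
(* With x = 2 e + 1, h + u factors as (y + z) (x + y) (z - x). [slide] exchanges y + z with z - x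
   and negates x + y. *)
rewrite (liouville (u := fun t : triple => let: (e, y, z) := t in
    (2 * e + 1) * (z ^+ 2 - y ^+ 2))).
- rewrite big_seq_cond big1 // => -[[e y] z] /andP[/gap_eq0 Pe /eqP /Pe].
  by case=> k /(congr1 odd); rewrite /= odd_double oddM /= andbN.
- by move=> [[e y] z]; rewrite /F /=; ring.
- by move=> [[e y] z] /=; ring.
- by move=> [[e y] z] /=; ring.
- by move=> [[e y] z] _; rewrite /F /=; ring.
Qed.

Lemma sig_recurrence n :
  \sum_(j <- pronic_below n.*2.+1)
     ((2 * n)%:Z - (5 * j * j.+1)%:Z) * (sig (n.*2.+1 - j * j.+1))%:Z = 0.
Proof.
have := sols_odd_sum n; rewrite big_sols => S0.
suff: 2 * \sum_(j <- pronic_below n.*2.+1)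
     ((2 * n)%:Z - (5 * j * j.+1)%:Z) * (sig (n.*2.+1 - j * j.+1))%:Z = 0.
  by move/eqP; rewrite mulf_eq0 => /eqP.
(* For both roots, (2 e + 1)^2 = 4 j (j + 1) + 1 and y z = 2 n + 1 - j (j + 1), so the factor of y
   is 2 n - 5 j (j + 1). *)
rewrite -[RHS]S0 mulr_sumr [LHS]big_seq [RHS]big_seq; apply: eq_bigr => j.
rewrite mem_pronic_below => jn.
rewrite /sig (big_morph Posz PoszD (erefl _)) !mulr_sumr.
rewrite [LHS]big_seq [RHS]big_seq; apply: eq_bigr => d.
rewrite -dvdn_divisors ?subn_gt0 // => /dvdnP[q cE].
have d0 : (0 < d)%N by lia.
by rewrite cE mulnK // NegzE; nia.
Qed.

(** * The second identity, from P = 2 n *)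

Definition tri (j : nat) : nat := (j * j.+1)./2.

Lemma tri_double j : (tri j).*2 = (j * j.+1)%N.
Proof. by apply: even_halfK; rewrite oddM /= andbN. Qed.

Lemma tri_inj : injective tri.
Proof. by move=> j k /(congr1 double); rewrite !tri_double; nia. Qed.

Definition alt_sig (m : nat) : int :=
  \sum_(d <- divisors m) (if odd d then d%:Z else - d%:Z).

Definition weight (t : triple) : int := let: (_, y, z) := t in
  if odd (absz z) then 0 else if odd (absz y) then y else - y.

(** For c = 2 k + 1 the summand is the even member of the pair y, c - y, so each even number from 2
    to 2 k is counted twice. *)
Lemma sum_even_members k c :
  \sum_(y <- iota 1 k.*2) (if odd y then c - y%:Z else y%:Z) = k%:Z * c + k%:Z.
Proof.
elim: k => [|k IH]; first by rewrite big_nil; lia.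
rewrite doubleS -addn2 iotaD big_cat /= {}IH !big_cons big_nil.
by rewrite add1n /= odd_double /=; lia.
Qed.

(** By [gap_eq0] such a solution is determined by y, and z > 0 bounds y by 2 k. *)
Lemma big_gap0 k (F : triple -> int) :
  \sum_(t <- sols (k * k.+1) | gap t == 0) F t =
  \sum_(y <- iota 1 k.*2) F (k%:Z - y%:Z, y%:Z, (k.*2.+1)%:Z - y%:Z).
Proof.
rewrite -big_filter -(big_map (fun y : nat =>
  (k%:Z - y%:Z, y%:Z, (k.*2.+1)%:Z - y%:Z)) xpredT).
apply/perm_big/uniq_perm; rewrite ?filter_uniq ?sols_uniq //.
  by rewrite map_inj_uniq ?iota_uniq // => y1 y2 [] _ [].
move=> [[e y] z]; rewrite mem_filter; apply/andP/mapP => [[/eqP g0 sol]|].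
  have [k' kk' [eE zE]] := gap_eq0 sol g0.
  have {}kk' : k' = k by nia.
  move: sol; rewrite mem_sols => /and3P[_ y0 z0].
  exists `|y|%N; first by rewrite mem_iota; lia.
  by congr (_, _, _); lia.
case=> y'; rewrite mem_iota mem_sols => y'P [-> -> ->].
split; first by apply/eqP => /=; lia.
by apply/and3P; split; [apply/eqP; lia | lia | lia].
Qed.

Lemma odd_member n (e y z : int) : e * (e + 1) + y * z = (n.*2)%:Z ->
  odd `|y|%N -> ~~ odd `|z|%N.
Proof.
move=> eqn yo; apply/negP => zo; move: eqn.
have [b ->] : exists b, y = 2 * b + 1 by exists (y %/ 2)%Z; lia.
have [c ->] : exists c, z = 2 * c + 1 by exists (z %/ 2)%Z; lia.
have [a [] ->] : exists a, e = 2 * a \/ e = 2 * a + 1 by exists (e %/ 2)%Z; lia.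
  by lia.
by lia.
Qed.

Lemma weight_sum_gap0 n :
  2 * \sum_(t <- sols n.*2) weight t =
  \sum_(t <- sols n.*2 | gap t == 0)
     (let: (_, y, z) := t in if odd (absz y) then z else y).
Proof.
transitivity (\sum_(t <- sols n.*2) (weight t + weight (swap t))).
  by rewrite big_split /= (big_swap _ weight) mulr_natl mulr2n.
(* With x = 2 e + 1, h + u is x + y for y odd and z even, z - x for y even and z odd, and - (y + z)
   for both even. [slide] negates the first value and exchanges the other two cases with a change of
   sign; y and z are never both odd by [odd_member]. *)
pose u (t : triple) : int := let: (e, y, z) := t in
  if odd (absz y) then (if odd (absz z) then 0 else 2 * e + 1)
  else if odd (absz z) then - (2 * e + 1) else 0.
rewrite (liouville (u := u)).
- rewrite big_seq_cond [RHS]big_seq_cond; apply: eq_bigr => -[[e y] z].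
  move=> /andP[_ /eqP /=]; rewrite /u.
  by case: ifP => ?; case: ifP => ? ?; lia.
- by move=> [[e y] z]; rewrite addrC.
- by move=> [[e y] z] /=; case: ifP; case: ifP; lia.
- by move=> [[e y] z] /=; case: ifP; case: ifP; lia.
- move=> [[e y] z]; rewrite mem_sols => /and3P[/eqP eqn y0 z0] /=.
  have := odd_member eqn; rewrite /u /=.
  have [yo /(_ isT) ze|ye _] := boolP (odd `|y|%N).
    have -> : odd (absz (z - (2 * e + 1) - y)%R) = false by lia.
    by rewrite (negPf ze); lia.
  have -> : odd (absz (z - (2 * e + 1) - y)%R) = ~~ odd `|z|%N by lia.
  by case: (odd `|z|%N) => /=; lia.
Qed.

Lemma weight_sum n :
  \sum_(t <- sols n.*2) weight t =
  if n \in [seq tri k | k <- iota 0 n.+1] then (n.*2)%:Z else 0.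
Proof.
have := weight_sum_gap0 n; case: mapP => [[k _ nk]|nk].
  have {}nk : n.*2 = (k * k.+1)%N by rewrite nk tri_double.
  rewrite nk big_gap0 => S2.
  suff : 2 * \sum_(t <- sols (k * k.+1)) weight t = 2 * (k * k.+1)%:Z by lia.
  by rewrite S2 [LHS](sum_even_members k (k.*2.+1)%:Z); lia.
rewrite [X in _ = X -> _]big_seq_cond [X in _ = X -> _]big1.
  by move/eqP; rewrite mulf_eq0 => /eqP.
move=> [[e y] z] /andP[sol /eqP g0].
by have [k kE _] := gap_eq0 sol g0; case: nk; exists k;
  [rewrite mem_iota; nia | have := tri_double k; lia].
Qed.

(** When y z = 2 m, the condition z even in [weight] amounts to y dividing m. *)
Lemma divisors_double m : (0 < m)%N ->
  perm_eq [seq d <- divisors m.*2 | ~~ odd (m.*2 %/ d)] (divisors m).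
Proof.
move=> m0; apply: uniq_perm; rewrite ?filter_uniq ?divisors_uniq // => d.
rewrite mem_filter -!dvdn_divisors ?double_gt0 //.
apply/andP/idP => [[+ /dvdnP[q qE]]|/dvdnP[q ->]].
  have d0 : (0 < d)%N by lia.
  rewrite qE mulnK // => /even_halfK qK; apply/dvdnP; exists q./2.
  by nia.
case: (posnP d) => [->|d0]; first by rewrite muln0.
by rewrite doubleMl mulnK // odd_double dvdn_mull.
Qed.

Lemma even_divisors m : (0 < m)%N ->
  perm_eq [seq d <- divisors m.*2 | ~~ odd d] (map double (divisors m)).
Proof.
move=> m0; apply: uniq_perm; rewrite ?filter_uniq ?divisors_uniq //.
  by rewrite (map_inj_uniq double_inj) divisors_uniq.
move=> d; rewrite mem_filter -dvdn_divisors ?double_gt0 //.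
apply/andP/mapP => [[/even_halfK dE]|[d' + ->]]; last first.
  by rewrite -dvdn_divisors // odd_double -!mul2n dvdn_pmul2l.
rewrite -{1}dE -!mul2n dvdn_pmul2l // => dm.
by exists d./2; rewrite -?dvdn_divisors.
Qed.

(** The alternating sum is the full sum minus twice the even divisors, and these are the doubles of
    the divisors of m / 2. *)
Lemma alt_sigE m : (0 < m)%N ->
  alt_sig m = (sig m)%:Z - (if odd m then 0 else 4 * (sig m./2)%:Z).
Proof.
move=> m0; rewrite /alt_sig /sig !(big_morph Posz PoszD (erefl _)).
transitivity (\sum_(d <- divisors m) d%:Z -
    2 * \sum_(d <- divisors m | ~~ odd d) d%:Z).
  rewrite (bigID odd) [X in _ = X - _](bigID odd) /= mulr_natl mulr2n.
  rewrite opprD addrA addrK; congr (_ + _); first by apply: eq_bigr => d ->.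
  by rewrite -sumrN; apply: eq_bigr => d /negPf ->.
congr (_ - _); case: ifPn => [mo|me].
  rewrite big_seq_cond big1 ?mulr0 // => d; rewrite -dvdn_divisors //.
  by case/andP=> /dvdn_odd /(_ mo) ->.
rewrite -[in LHS](even_halfK me) -[X in 2 * X]big_filter.
rewrite (perm_big _ (even_divisors _)).
  by rewrite big_map !mulr_sumr; apply: eq_bigr => d _; lia.
by have := even_halfK me; lia.
Qed.

Lemma weight_divisors_sum e m : (0 < m)%N ->
  \sum_(d <- divisors m.*2) weight (e, d%:Z, (m.*2 %/ d)%:Z) = alt_sig m.
Proof.
move=> m0; rewrite /alt_sig -(perm_big _ (divisors_double m0)) /= big_filter.
rewrite [RHS]big_mkcond; apply: eq_bigr => d _ /=.
by case: (odd (_ %/ _)).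
Qed.

Lemma alt_sig_sum n :
  \sum_(j <- pronic_below n.*2) alt_sig (n - tri j) =
  if n \in [seq tri k | k <- iota 0 n.+1] then n%:Z else 0.
Proof.
suff : 2 * \sum_(j <- pronic_below n.*2) alt_sig (n - tri j) =
   \sum_(t <- sols n.*2) weight t by rewrite weight_sum; case: ifP; lia.
rewrite big_sols mulr_sumr [LHS]big_seq [RHS]big_seq; apply: eq_bigr => j.
rewrite mem_pronic_below -tri_double ltn_double => jn.
(* [weight] ignores e, so the value 0 serves for both roots. *)
rewrite -doubleB big_split /= !(weight_divisors_sum 0) ?subn_gt0 //.
by rewrite mulr_natl mulr2n.
Qed.

(* [alt_sig 0] is 1, because [divisors 0 = [:: 1]]. *)
Definition psi_logderiv (m : nat) : int := if m is 0 then 0 else alt_sig m.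

Lemma big_pronic_below (V : nmodType) N P (F : nat -> V) : (P <= N.*2)%N ->
  \sum_(j <- iota 0 N | (j * j.+1 < P)%N) F j = \sum_(j <- pronic_below P) F j.
Proof.
move=> PN; rewrite -big_filter; apply/perm_big/uniq_perm.
- by rewrite filter_uniq ?iota_uniq.
- exact: pronic_below_uniq.
move=> j; rewrite mem_pronic_below mem_filter mem_iota add0n /=.
by case: ltnP => //= jP; nia.
Qed.

(** * The third identity, with power series replaced by polynomials that are correct below degree
    N *)

Section PowerSeries.

Variable N : nat.

(** Since tri j >= j, the indices j < N supply every term of psi of degree below N. *)
Let T : {poly int} := \sum_(j <- iota 0 N) 'X^(tri j).
Let L : {poly int} := \poly_(i < N) psi_logderiv i.
Let F : {poly int} := \poly_(i < N) (sig i.*2.+1)%:Z.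

Lemma coef_Xderiv (p : {poly int}) i : ('X * p^`())`_i = i%:Z * p`_i.
Proof.
rewrite coefXM coef_deriv; case: i => [|i].
  by rewrite /= mul0r.
by rewrite /= mulrC -mulr_natr natz.
Qed.

(** As j (j + 1) = 2 tri j, the bound j (j + 1) < 2 n + 1 says tri j <= n. *)
Lemma coef_mul_psi (p : {poly int}) n : (n < N)%N ->
  (p * T)`_n = \sum_(j <- pronic_below n.*2.+1) p`_(n - tri j).
Proof.
move=> nN; rewrite mulr_sumr coef_sum -(@big_pronic_below _ N); last by lia.
rewrite [RHS]big_mkcond; apply: eq_bigr => j _; rewrite coefMXn.
by have := tri_double j; case: ltnP => ?; case: ltnP => ? //; lia.
Qed.

Lemma coef_psi n : (n < N)%N -> T`_n = (n \in [seq tri k | k <- iota 0 n.+1])%:R.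
Proof.
move=> nN; rewrite coef_sum.
have -> : (n \in [seq tri k | k <- iota 0 n.+1]) =
    (n \in [seq tri k | k <- iota 0 N]).
  apply/mapP/mapP => -[k]; rewrite mem_iota => kn nE; exists k => //;
    rewrite mem_iota; have := tri_double k; nia.
rewrite -count_uniq_mem; last by rewrite (map_inj_uniq tri_inj) iota_uniq.
rewrite -sum1_count big_map natr_sum [RHS]big_mkcond; apply: eq_bigr => j _.
by rewrite coefXn /= eq_sym; case: eqP.
Qed.

Lemma psi_logderivE n : (n < N)%N -> (L * T)`_n = ('X * T^`())`_n.
Proof.
move=> nN; rewrite coef_Xderiv coef_psi // coef_mul_psi //.
(* The ranges differ by the possible index with tri j = n, whose term is [psi_logderiv 0], that is
   0. *)
transitivity (\sum_(j <- pronic_below n.*2) alt_sig (n - tri j)).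
  rewrite -(@big_pronic_below _ N); last by lia.
  rewrite -(@big_pronic_below _ N); last by lia.
  rewrite [LHS]big_mkcond [RHS]big_mkcond; apply: eq_bigr => j _.
  rewrite coef_poly; have -> : (n - tri j < N)%N by lia.
  rewrite -tri_double ltnS leq_double ltn_double.
  case: (ltngtP (tri j) n) => [jn|//|->]; last by rewrite subnn.
  by have : (0 < n - tri j)%N; [lia | case: (n - tri j)%N].
by rewrite alt_sig_sum; case: ifP => _; rewrite ?mulr1 ?mulr0.
Qed.

(** This is [sig_recurrence] read on coefficients: with t = tri j, twice (n - t) - 4 t is 2 n - 5 j
    (j + 1). *)
Lemma sig_psiE n : (n < N)%N ->
  ('X * F^`() * T)`_n = (4%:R *: (F * ('X * T^`())))`_n.
Proof.
move=> nN.
have XT : 'X * T^`() = \sum_(j <- iota 0 N) (tri j)%:Z *: 'X^(tri j).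
  apply/polyP => i; rewrite coef_Xderiv !coef_sum mulr_sumr.
  apply: eq_bigr => j _; rewrite coefZ coefXn.
  by case: eqP => [->|]; rewrite ?mulr0.
rewrite coef_mul_psi // coefZ XT mulr_sumr coef_sum.
have -> : \sum_(j <- iota 0 N) (F * ((tri j)%:Z *: 'X^(tri j)))`_n =
    \sum_(j <- pronic_below n.*2.+1) (tri j)%:Z * F`_(n - tri j).
  rewrite -(@big_pronic_below _ N); last by lia.
  rewrite [RHS]big_mkcond; apply: eq_bigr => j _.
  rewrite -scalerAr coefZ coefMXn.
  have := tri_double j.
  by case: ltnP => ?; case: ltnP => ? //; rewrite ?mulr0 //; lia.
apply/eqP; rewrite -subr_eq0 mulr_sumr -sumrB; apply/eqP.
suff : 2 * \sum_(j <- pronic_below n.*2.+1) (('X * F^`())`_(n - tri j) -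
    4%:R * ((tri j)%:Z * F`_(n - tri j))) = 0.
  by move/eqP; rewrite mulf_eq0 => /eqP.
rewrite -[RHS](sig_recurrence n) mulr_sumr [LHS]big_seq [RHS]big_seq.
apply: eq_bigr => j; rewrite mem_pronic_below -mulnA -tri_double => jn.
rewrite coef_Xderiv coef_poly ifT; last by lia.
have -> : (n.*2.+1 - (tri j).*2 = (n - tri j).*2.+1)%N by lia.
rewrite mulrA mulrBr !mulrA -!mulrBl; congr (_ * _); lia.
Qed.

(** The constant coefficient of [T] is 1, so the coefficients of [p] vanish one after the other. *)
Lemma psi_cancel (p : {poly int}) :
  (forall n, (n < N)%N -> (p * T)`_n = 0) -> forall n, (n < N)%N -> p`_n = 0.
Proof.
move=> pT n; elim/ltn_ind: n => n IH nN.
have N_gt0 : (0 < N)%N by lia.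
have := pT n nN.
rewrite coefM big_ord_recr /= subnn coef_psi // mulr1 big1 ?add0r // => i _.
by rewrite IH ?mul0r //; have := ltn_ord i; lia.
Qed.

Lemma sig_convolution_lt n : (n < N)%N ->
  n%:Z * (sig n.*2.+1)%:Z =
  4 * \sum_(i < n.+1) psi_logderiv i * (sig (n - i).*2.+1)%:Z.
Proof.
move=> nN; apply/eqP; rewrite -subr_eq0; apply/eqP.
transitivity ('X * F^`() - 4%:R *: (L * F))`_n.
  rewrite coefB coef_Xderiv coefZ coefM coef_poly nN; congr (_ - 4 * _).
  apply: eq_bigr => i _; have := ltn_ord i => ?.
  by rewrite !coef_poly !ifT //; lia.
(* After multiplication by [T], the difference agrees below degree N with 4 F (X T' - L T), where
   [psi_logderivE] applies. *)
apply: psi_cancel nN => k kN; rewrite mulrBl coefB sig_psiE // -scalerAl !coefZ.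
rewrite mulrAC [L * T * F]mulrC !coefM -mulrBr -sumrB big1 ?mulr0 // => i _.
by rewrite psi_logderivE ?subrr //; lia.
Qed.

End PowerSeries.

Lemma sig_convolution n :
  n%:Z * (sig n.*2.+1)%:Z =
  4 * \sum_(i < n.+1) psi_logderiv i * (sig (n - i).*2.+1)%:Z.
Proof. exact: (@sig_convolution_lt n.+1). Qed.

(** * Passage to the rational function [sigma] and to finitely supported sums *)

Lemma sigma_nat m : (0 < m)%N -> sigma m%:R = (sig m)%:R.
Proof.
move=> m0; rewrite /sigma ltr0n m0 andbT rpred_nat.
by have /= := numq_int m%:Z => ->.
Qed.

Lemma half_int m : ((m%:R / 2 : rat) \is a Num.int) = ~~ odd m.
Proof.
apply/intrP/idP => [[k kE]|/even_halfK <-].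
  have : (m%:Z)%:~R = (k * 2)%:~R :> rat.
    by rewrite intrM -kE divfK.
  by move/intr_inj; lia.
by exists (m./2)%:Z; rewrite -muln2 natrM mulfK.
Qed.

Lemma sigma_half m : (0 < m)%N ->
  sigma (m%:R / 2) = if odd m then 0 else (sig m./2)%:R.
Proof.
move=> m0; case: ifPn => mo; first by rewrite /sigma half_int mo.
rewrite -[in LHS](even_halfK mo) -muln2 natrM mulfK // sigma_nat //.
by have := even_halfK mo; lia.
Qed.

Lemma psi_logderiv_sigma m :
  sigma m%:R - 4 * sigma (m%:R / 2) = (psi_logderiv m)%:~R.
Proof.
case: m => [|m]; first by rewrite mul0r !sigma_le0 // mulr0 subrr.
rewrite sigma_nat // sigma_half // /psi_logderiv alt_sigE // intrB.
by case: ifP => _; rewrite ?mulr0 // intrM.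
Qed.

Lemma natr_tri j : j%:R * (j%:R + 1) / 2 = (tri j)%:R :> rat.
Proof.
by rewrite natr1 -natrM -tri_double -muln2 natrM mulfK.
Qed.

Lemma triangular_int n :
  (exists j : int, n%:R = j%:~R * (j%:~R + 1) / 2 :> rat) <->
  n \in [seq tri k | k <- iota 0 n.+1].
Proof.
split=> [[j nE]|/mapP[k _ ->]]; last by exists k%:Z; rewrite natr_tri.
have {nE} : (n * 2)%:Z%:~R = (j * (j + 1))%:~R :> rat.
  by rewrite PoszM !intrM intrD -pmulrn nE divfK.
move/intr_inj => nE; apply/mapP.
have [k kE] : exists k : nat, (k * k.+1 = n * 2)%N.
  (* A negative j gives the same triangular number as - j - 1, which is the absolute value of j +
     1. *)
  by exists (if 0 <= j then absz j else absz (j + 1)%R); case: ifP; nia.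
exists k; first by rewrite mem_iota; nia.
by apply: double_inj; rewrite tri_double kE muln2.
Qed.

Lemma fsum_nat (V : nmodType) (A : set nat) (r : seq nat) (f : nat -> V) :
  uniq r -> (forall i, i \in r -> A i) ->
  (forall i, A i -> i \notin r -> f i = 0) ->
  \sum_(i \in A) f i = \sum_(i <- r) f i.
Proof.
move=> ur rA f0; rewrite (fsbigE r) // big_seq_cond [RHS]big_seq.
by apply: eq_bigl => i; apply: andb_idr => /rA; rewrite in_setE.
Qed.

Local Open Scope classical_set_scope.

Theorem theorem2 (n : nat) (n_gt0 : (0 < n)%N) :
  [/\ 2 * n%:R * sigma (2 * n%:R + 1) =
      \sum_(j \in [set j : nat | (1 <= j)%N])
         (5 * j%:R * (j%:R + 1) - 2 * n%:R)
         * sigma (2 * n%:R + 1 - j%:R * (j%:R + 1)),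
      \sum_(j \in [set: nat])
         (sigma (n%:R - j%:R * (j%:R + 1) / 2)
          - 4 * sigma (1 / 2 * (n%:R - j%:R * (j%:R + 1) / 2))) =
      (if `[< exists j : int, n%:R = j%:~R * (j%:~R + 1) / 2 :> rat >]
       then n%:R else 0)
    & n%:R * sigma (2 * n%:R + 1) =
      4 * \sum_(j \in [set j : nat | (1 <= j)%N])
            (sigma j%:R - 4 * sigma (j%:R / 2))
            * sigma (2 * n%:R + 1 - 2 * j%:R)].
Proof.
have double_natr k : 2 * k%:R + 1 = k.*2.+1%:R :> rat.
  by rewrite -[RHS]natr1 -mul2n natrM.
split.
- move: (sig_recurrence n) (mem_pronic_below n.*2.+1) (pronic_below_uniq n.*2.+1).
  move: (pronic_below _) => r rec mem_r uniq_r.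
  rewrite (@fsum_nat _ _ [seq j <- r | j != 0%N]).
  + have := congr1 (fun x : int => x%:~R : rat) rec.
    (* The term j = 0 of the recurrence is 2 n sigma(2 n + 1); moving the other terms across changes
       their sign. *)
    rewrite (bigD1_seq 0%N) ?mem_r ?uniq_r //= => /eqP.
    rewrite rmorphD addr_eq0 /= => /eqP; rewrite ?muln0 ?mul0n subn0 subr0 intrM.
    rewrite double_natr sigma_nat // -natrM => ->.
    rewrite -big_filter rmorph_sum -sumrN /= [LHS]big_seq [RHS]big_seq.
    apply: eq_bigr => j; rewrite mem_filter mem_r => /andP[_ jn].
    rewrite natr1 -[j%:R * _]natrM -natrB 1?ltnW // sigma_nat ?subn_gt0 //.
    rewrite intrM -mulNr; congr (_ * _).
    by rewrite intrB opprB -!natrM.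
  + by rewrite filter_uniq ?uniq_r.
  + by move=> j /=; rewrite mem_filter -lt0n => /andP[].
  + move=> j /= j0; rewrite mem_filter -lt0n j0 mem_r -leqNgt => jn.
    by rewrite sigma_le0 ?mulr0 // double_natr natr1 -natrM subr_le0 ler_nat.
- rewrite (@fsum_nat _ _ (pronic_below n.*2)) ?pronic_below_uniq //.
  + transitivity ((\sum_(j <- pronic_below n.*2) alt_sig (n - tri j))%:~R : rat).
      rewrite rmorph_sum [LHS]big_seq [RHS]big_seq; apply: eq_bigr => j.
      rewrite mem_pronic_below -tri_double ltn_double => jn.
      rewrite natr_tri -natrB 1?ltnW // mul1r [_^-1 * _]mulrC psi_logderiv_sigma.
      by have : (0 < n - tri j)%N; [rewrite subn_gt0 | case: (n - tri j)%N].
    rewrite alt_sig_sum; case: asboolP => [/triangular_int ->//|ntri].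
    by case: ifP => // /triangular_int.
  + move=> j _; rewrite mem_pronic_below -tri_double ltn_double -leqNgt => jn.
    rewrite natr_tri !sigma_le0 ?mulr0 ?subrr // ?subr_le0 ?ler_nat //.
    by rewrite mulr_ge0_le0 ?subr_le0 ?ler_nat.
- rewrite (@fsum_nat _ _ (iota 1 n)) ?iota_uniq //.
  + rewrite double_natr sigma_nat //.
    have := congr1 (fun x : int => x%:~R : rat) (sig_convolution n).
    (* The convolution starts at 0 and the statement at 1; the extra term vanishes since
       [psi_logderiv 0] is 0. *)
    rewrite /= !intrM big_ord_recl mul0r add0r => ->; congr (_ * _).
    rewrite rmorph_sum /= -[1%N]addn0 iotaDl big_map -[n in iota _ n]subn0.
    rewrite -/(index_iota 0 n) big_mkord; apply: eq_bigr => j _.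
    rewrite psi_logderiv_sigma intrM; congr (_ * _).
    have jn := ltn_ord j; rewrite -natrM -natrB ?sigma_nat; try lia.
    by congr ((sig _)%:R); rewrite /bump /=; lia.
  + by move=> j /=; rewrite mem_iota => /andP[].
  + move=> j /= j0; rewrite mem_iota j0 add1n -leqNgt => jn.
    rewrite [sigma (2 * n%:R + 1 - _)]sigma_le0 ?mulr0 // double_natr -natrM.
    by rewrite subr_le0 ler_nat; lia.
Qed.
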